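(* For every integer $d\ge1$, let $L_d^{\mathrm{trap}}=\{w\in\{0,1\}^*\mid |w|_0=|w|_1=2d,\ (\exists i\in\{1,\dots,d\}:\ \delta_{i,i}^{2d}(w)\in\{0101,1010,0110,1001\})\ \text{or}\ (\exists i\in\{1,\dots,d-1\}:\ \delta_{i,i}^{2d\to4}(w)\in\{00111100,11000011\})\}$. Then $L_d^{\mathrm{trap}}$ is $2d$-uniform and $\mathcal{G}_{L_d^{\mathrm{trap}}}$ is exactly the class of $d$-trapezoid graphs.
   Context: $|w|_a$ is the number of occurrences of letter $a$ in $w$; a binary word is $k$-uniform if it has exactly $k$ occurrences of $0$ and of $1$. For a $2d$-uniform binary word $w$: $\delta_{i,i}^{2d}(w)$ keeps only the $(2i-1)$-st and $2i$-th occurrences of $0$ and of $1$ (deleting all other letters), and $\delta_{i,i}^{2d\to4}(w)$ keeps only the $(2i-1)$-st through $(2i+2)$-nd occurrences of $0$ and of $1$. For a word $w$ and distinct letters $a,b$, $h_{a,b}(w)$ replaces $a$ by $0$, $b$ by $1$ and deletes other letters. For $L\subseteq\{0,1\}^*$ closed under exchanging $0$ and $1$ and a word $w$ with letter set $V$, $G(L,w)$ is the graph on $V$ where distinct $u,v$ are adjacent iff $h_{u,v}(w)\in L$; $\mathcal{G}_L$ is the class of graphs isomorphic to some $G(L,w)$. A $d$-trapezoid graph is the intersection graph of $d$-trapezoids between $d$ fixed parallel lines $L_1,\dots,L_d$ (in this order): a $d$-trapezoid is given by intervals $[\ell_i,r_i]$ on $L_i$ ($i=1,\dots,d$) and is the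 region bounded by the polygon connecting $\ell_i$ to $\ell_{i+1}$ for $i<d$, $\ell_d$ to $r_d$, $r_{i+1}$ to $r_i$ for $i<d$, and $r_1$ to $\ell_1$. *)

(* Defs.v *)
From HB Require Import structures.
From mathcomp Require Import all_boot all_order all_algebra.
From mathcomp Require Import all_classical all_reals all_analysis.
Set Implicit Arguments.
Unset Strict Implicit.
Unset Printing Implicit Defensive.
Import Order.TTheory GRing.Theory Num.Theory.
Import numFieldNormedType.Exports.
Local Open Scope classical_set_scope.
Local Open Scope ring_scope.

Record sgraph := SGraph {
  vertex :> finType;
  edge : rel vertex;
  edge_sym : symmetric edge;
  edge_irr : irreflexive edge }.

Definition isomorphic (G H : sgraph) : Prop :=
  exists f : G -> H,
    bijective f /\ forall u v : G, edge (f u) (f v) = edge u v.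

(* The letter 0 is [false] and 1 is [true]. *)

Definition uniform_word (k : nat) (w : seq bool) : bool :=
  (count_mem false w == k) && (count_mem true w == k).

Record lang := Lang {
  mem_lang :> pred (seq bool);
  lang_exchange : forall w, mem_lang (map negb w) = mem_lang w }.

Definition uniform_lang (k : nat) (L : lang) : Prop :=
  forall w, L w -> uniform_word k w.

Definition occ_index (w : seq bool) (p : nat) : nat :=
  count_mem (nth false w p) (take p.+1 w).

(* Keeps the m-th occurrences of 0 and of 1 for m in K; occurrences are
   numbered from 1. *)
Definition keep_occ (K : pred nat) (w : seq bool) : seq bool :=
  [seq nth false w p | p <- iota 0 (size w) & K (occ_index w p)].

Definition delta (i : nat) (w : seq bool) : seq bool :=
  keep_occ [pred m | 2 * i - 1 <= m <= 2 * i]%N w.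

Definition delta4 (i : nat) (w : seq bool) : seq bool :=
  keep_occ [pred m | 2 * i - 1 <= m <= 2 * i + 2]%N w.

Definition proj_word (A : eqType) (a b : A) (w : seq A) : seq bool :=
  pmap (fun x => if x == a then Some false
                 else if x == b then Some true else None) w.

Lemma proj_word_exchange (A : eqType) (a b : A) (w : seq A) :
  a != b -> proj_word b a w = map negb (proj_word a b w).
Proof.
move=> ab; elim: w => //= x w IH.
case: (eqVneq x b) => [->|xb]; first by rewrite eq_sym (negbTE ab) /= IH.
by case: (eqVneq x a) => _ /=; rewrite IH.
Qed.

Definition word_edge (L : lang) (A : choiceType) (w : seq A) :
    rel (seq_sub w) :=
  fun u v => (u != v) && L (proj_word (val u) (val v) w).

Lemma word_edge_sym (L : lang) (A : choiceType) (w : seq A) :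
  symmetric (@word_edge L A w).
Proof.
move=> u v; rewrite /word_edge eq_sym.
case: (eqVneq v u) => //= vu.
by rewrite (@proj_word_exchange _ (val u)) ?lang_exchange // eq_sym.
Qed.

Lemma word_edge_irr (L : lang) (A : choiceType) (w : seq A) :
  irreflexive (@word_edge L A w).
Proof. by move=> u; rewrite /word_edge eqxx. Qed.

Definition word_graph (L : lang) (A : choiceType) (w : seq A) : sgraph :=
  @SGraph (seq_sub w) (@word_edge L A w)
    (@word_edge_sym L A w) (@word_edge_irr L A w).

Definition in_lang_class (L : lang) (G : sgraph) : Prop :=
  exists (A : choiceType) (w : seq A), isomorphic G (word_graph L w).

Local Notation b0 := false.
Local Notation b1 := true.

Definition trap_pred (d : nat) : pred (seq bool) := fun w =>
  [&& count_mem b0 w == (2 * d)%N, count_mem b1 w == (2 * d)%N &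
      has (fun i => delta i w \in
             [:: [:: b0; b1; b0; b1]; [:: b1; b0; b1; b0];
                 [:: b0; b1; b1; b0]; [:: b1; b0; b0; b1]])
          (iota 1 d)
      || has (fun i => delta4 i w \in
                [:: [:: b0; b0; b1; b1; b1; b1; b0; b0];
                    [:: b1; b1; b0; b0; b0; b0; b1; b1]])
             (iota 1 d.-1)].

Lemma count_mem_negb (b : bool) (w : seq bool) :
  count_mem b (map negb w) = count_mem (~~ b) w.
Proof. by rewrite count_map; apply: eq_count => x /=; case: x b => [] []. Qed.

Lemma keep_occ_negb (K : pred nat) (w : seq bool) :
  keep_occ K (map negb w) = map negb (keep_occ K w).
Proof.
rewrite /keep_occ size_map -map_comp.
have H p : p \in iota 0 (size w) -> nth false (map negb w) p = ~~ nth false w p.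
  by rewrite mem_iota => /= pw; rewrite (nth_map false).
rewrite (@eq_in_filter _ _ (fun p => K (occ_index w p))); last first.
  by move=> p /H E; rewrite /occ_index E -map_take count_mem_negb negbK.
by apply/eq_in_map => p; rewrite mem_filter => /andP[_ /H].
Qed.

Lemma mem_exchange (S : seq (seq bool)) (w : seq bool) :
  map (map negb) S =i S -> (map negb w \in S) = (w \in S).
Proof. by move=> ES; rewrite -ES mem_map //; apply/inj_map/negb_inj. Qed.

Lemma trap_pred_exchange (d : nat) (w : seq bool) :
  trap_pred d (map negb w) = trap_pred d w.
Proof.
rewrite /trap_pred !count_mem_negb [LHS]andbCA; congr [&& _, _ & _ || _].
- apply: eq_has => i; rewrite {1}/delta keep_occ_negb.
  apply: mem_exchange => x; rewrite !inE.
  by rewrite orbCA; congr (_ || (_ || _)); rewrite orbC.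
- apply: eq_has => i; rewrite {1}/delta4 keep_occ_negb.
  by apply: mem_exchange => x; rewrite !inE orbC.
Qed.

Definition Ltrap (d : nat) : lang := Lang (@trap_pred_exchange d).

Section Trapezoids.
Variable R : realType.
Local Notation plane := (R * R)%type.

Definition segment (p q : plane) : set plane :=
  [set ((1 - t) * p.1 + t * q.1, (1 - t) * p.2 + t * q.2) | t in `[0, 1]].

(* The closed region bounded by the closed curve C: the curve together with
   the bounded connected components of its complement. It also makes sense for
   the degenerate polygons obtained when some l_i = r_i, or when d = 1. *)
Definition region (C : set plane) : set plane :=
  C `|` [set p | (~` C) p /\ bounded_set (connected_component (~` C) p)].

(* Coordinates are chosen so that the i-th parallel line is the horizontal
   line of ordinate h i, for i : 'I_d; [l i, r i] is the interval on it. *)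
Definition trapezoid_polygon (d : nat) (h l r : 'I_d -> R) : set plane :=
  [set p |
    [\/ exists i j : 'I_d, j = i.+1 :> nat /\
          segment (l i, h i) (l j, h j) p,
        exists i : 'I_d, i.+1 = d /\ segment (l i, h i) (r i, h i) p,
        exists i j : 'I_d, j = i.+1 :> nat /\
          segment (r j, h j) (r i, h i) p |
        exists i : 'I_d, i = 0%N :> nat /\
          segment (r i, h i) (l i, h i) p]].

Definition trapezoid (d : nat) (h l r : 'I_d -> R) : set plane :=
  region (trapezoid_polygon h l r).

Definition trapezoid_graph (d : nat) (h : 'I_d -> R) (G : sgraph) : Prop :=
  exists l r : G -> 'I_d -> R,
    (forall v i, l v i <= r v i) /\
    forall u v : G, u != v ->
      (edge u v <->
       trapezoid h (l u) (r u) `&` trapezoid h (l v) (r v) !=set0).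

End Trapezoids.

(* Main.v *)
Require Import Defs.
From mathcomp Require Import all_boot all_order all_algebra.
From mathcomp Require Import all_classical all_reals all_analysis.
From mathcomp Require Import ring lra zify.
Import Order.TTheory GRing.Theory Num.Theory.
Import numFieldNormedType.Exports.
Local Open Scope classical_set_scope.
Local Open Scope ring_scope.
Set Implicit Arguments.
Unset Strict Implicit.
Unset Printing Implicit Defensive.

(* The region bounded by a trapezoid is the set of points between two piecewise
   linear functions: points outside escape to infinity along a horizontal
   half-line, and the interior is clopen in the complement of the polygon. Hence
   two trapezoids meet iff their intervals overlap on some line or change their
   order between two consecutive lines, a condition on the truth values of the
   comparisons of left ends with right ends. For a pair of letters of a word,
   the language tests the same condition on the positions of the occurrences, the
   (2i-1)-st and 2i-th occurrences being the two ends on line i. So positions in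
   a word serve as coordinates, and conversely a word is read off a family of
   trapezoids by sorting all ends line by line. *)

(* [p k] stands for [l k <= r' k] and [q k] for [l' k <= r k]: either the two
   intervals overlap on some line, or their order is exchanged between two
   consecutive lines. *)
Definition meet (n : nat) (p q : pred nat) : Prop :=
  (exists2 k, (k <= n)%N & p k && q k) \/
  (exists2 k, (k < n)%N & ~~ q k && ~~ p k.+1 || ~~ p k && ~~ q k.+1).

Lemma eq_meet (n : nat) (p q p' q' : pred nat) :
  (forall k, (k <= n)%N -> p k = p' k) ->
  (forall k, (k <= n)%N -> q k = q' k) ->
  meet n p q <-> meet n p' q'.
Proof.
move=> pE qE; split=> -[[k kn H]|[k kn H]].
- by left; exists k; rewrite -?pE -?qE.
- by right; exists k; rewrite -?pE -?qE // ltnW.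
- by left; exists k; rewrite ?pE ?qE.
- by right; exists k; rewrite ?pE ?qE // ltnW.
Qed.

(** The second trapezoid then lies strictly to the right on every line, which excludes both an
    overlap and an exchange. *)
Lemma not_meet (n : nat) (p q : pred nat) :
  (forall k, (k <= n)%N -> p k && ~~ q k) -> ~ meet n p q.
Proof.
move=> H [[k kn]|[k kn]].
  by case/andP: (H k kn) => -> /negbTE ->.
case/andP: (H k (ltnW kn)) => -> /negbTE ->.
by case/andP: (H k.+1 kn) => -> /negbTE ->.
Qed.

Lemma meetC (n : nat) (p q : pred nat) : meet n p q <-> meet n q p.
Proof.
have S p' q' : meet n p' q' -> meet n q' p'.
  case=> [[k kn]|[k kn]]; first by rewrite andbC => H; left; exists k.
  by rewrite orbC => H; right; exists k.
by split; exact: S.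
Qed.

(** * Piecewise linear functions and the region of a trapezoid *)

Section PiecewiseLinear.
Variables (R : realType) (h : nat -> R) (n : nat).
Hypothesis h_lt : forall k, (k < n)%N -> h k < h k.+1.

(** The projection of the real line onto [0, 1]; it makes each summand of [pl] constant outside its
    own segment. *)
Definition clamp (t : R) : R := Num.max 0 (Num.min 1 t).

Lemma clamp_le0 t : t <= 0 -> clamp t = 0.
Proof. by move=> t0; rewrite /clamp max_l // ge_min t0 orbT. Qed.

Lemma clamp_ge1 t : 1 <= t -> clamp t = 1.
Proof. by move=> t1; rewrite /clamp min_l // max_r. Qed.

Lemma clamp_id t : 0 <= t <= 1 -> clamp t = t.
Proof. by move=> /andP[t0 t1]; rewrite /clamp min_r // max_r. Qed.

Lemma clamp_norm_le1 t : `|clamp t| <= 1.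
Proof.
rewrite ger0_norm; first by rewrite /clamp ge_max ler01 ge_min lexx.
by rewrite /clamp le_max lexx.
Qed.

Lemma clamp_continuous : continuous clamp.
Proof.
move=> t; apply: continuous_max; first exact: cvg_cst.
apply: continuous_min; [exact: cvg_cst | exact: cvg_id].
Qed.

(* The function linear on each [h k, h k.+1] with value [a k] at [h k], constant
   outside [h 0, h n]. *)
Definition pl (a : nat -> R) (y : R) : R :=
  a 0%N + \sum_(k < n) (a k.+1 - a k) * clamp ((y - h k) / (h k.+1 - h k)).

Lemma h_le (i j : nat) : (i <= j <= n)%N -> h i <= h j.
Proof.
move=> /andP[]; elim: j => [|j IH]; first by rewrite leqn0 => /eqP ->.
rewrite leq_eqVlt => /orP[/eqP -> //|ij jn].
by apply: (le_trans (IH ij (ltnW jn))); exact: ltW (h_lt jn).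
Qed.

(** The summands before the k-th are saturated and telescope to [a k - a 0], those after it vanish,
    and the k-th contributes [t * (a k.+1 - a k)]. *)
Lemma pl_segment (a : nat -> R) (k : nat) (t : R) :
  (k < n)%N -> 0 <= t <= 1 ->
  pl a ((1 - t) * h k + t * h k.+1) = (1 - t) * a k + t * a k.+1.
Proof.
move=> kn t01; have hk := h_lt kn; set y := _ + _.
have yk : h k <= y <= h k.+1.
  by rewrite /y; move: t01 hk => /andP[t0 t1] hk; apply/andP; split; nra.
have hkn : h k.+1 - h k != 0 by rewrite subr_eq0 gt_eqF.
rewrite /pl.
rewrite -(big_mkord xpredT
  (fun j => (a j.+1 - a j) * clamp ((y - h j) / (h j.+1 - h j)))).
rewrite (@big_cat_nat _ _ _ k.+1) //= big_nat_recr //=.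
under eq_big_nat => j /andP[_ jk].
  have jn : (j < n)%N := ltn_trans jk kn.
  rewrite clamp_ge1 ?mulr1; last first.
    rewrite ler_pdivlMr ?subr_gt0 ?h_lt // mul1r lerD2r.
    by apply: le_trans (_ : h k <= _);
      [apply: h_le; rewrite jk ltnW|case/andP: yk].
  over.
rewrite telescope_sumr // [X in _ + (_ + X)]big_nat big1 ?addr0; last first.
  move=> j /andP[kj jn]; rewrite clamp_le0 ?mulr0 //.
  rewrite pmulr_lle0 ?invr_gt0 ?subr_gt0 ?h_lt // subr_le0.
  by case/andP: yk => _ /le_trans; apply; apply: h_le; rewrite kj ltnW.
have -> : (y - h k) / (h k.+1 - h k) = t by rewrite /y; field.
by rewrite clamp_id //; ring.
Qed.

Lemma pl_node (a : nat -> R) (k : nat) : (k <= n)%N -> pl a (h k) = a k.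
Proof.
move=> kn; case: (ltnP k n) => [kn'|nk].
  have := @pl_segment a k 0 kn'; rewrite lexx ler01 => /(_ isT).
  by rewrite subr0 !mul1r !mul0r !addr0.
(* The last node starts no segment: it ends the previous one, or [n = 0] and the sum is empty. *)
have {kn nk} -> : k = n by apply/eqP; rewrite eqn_leq kn nk.
case: (posnP n) => [n0|n0].
  rewrite /pl big1 ?addr0 ?n0 //; by case.
have nn : (n.-1 < n)%N by rewrite prednK.
have := @pl_segment a n.-1 1 nn; rewrite (prednK n0) lexx ler01 => /(_ isT).
by rewrite subrr !mul1r !mul0r !add0r.
Qed.

(* The first alternative is needed for [n = 0], where there is no segment. *)
Lemma locate y : h 0%N <= y <= h n ->
  y = h n \/ exists2 k, (k < n)%N &
    exists2 t, 0 <= t <= 1 & y = (1 - t) * h k + t * h k.+1.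
Proof.
move=> /andP[y0 yn].
have [|] := leP (h n) y; first by move=> ny; left; apply/eqP; rewrite eq_le yn.
move=> {}yn; right.
have ex : exists m, y < h m by exists n.
(* The least node above [y] closes the segment that contains [y]. *)
case: (ex_minnP ex) => -[|k] yk kmin; first by move: yk; rewrite ltNge y0.
have kn : (k < n)%N by apply: kmin.
have ky : h k <= y by rewrite leNgt; apply/negP => /kmin; rewrite ltnn.
have hk := h_lt kn; have hk0 : 0 < h k.+1 - h k by rewrite subr_gt0.
exists k => //; exists ((y - h k) / (h k.+1 - h k)); last first.
  by field; rewrite gt_eqF.
rewrite divr_ge0 ?subr_ge0 ?(ltW hk) //= ler_pdivrMr // mul1r lerD2r.
exact: ltW.
Qed.

Lemma pl_lt (a b : nat -> R) y : (forall k, (k <= n)%N -> a k < b k) ->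
  h 0%N <= y <= h n -> pl a y < pl b y.
Proof.
move=> ab /locate[->|[k kn [t t01 ->]]]; first by rewrite !pl_node // ab.
rewrite !pl_segment //; have := ab _ (ltnW kn); have := ab _ kn.
(* One of the weights [t] and [1 - t] is at least one half, which keeps the inequality strict. *)
by case/andP: t01 => t0 t1; case: (leP t 2^-1) => t2; nra.
Qed.

Lemma pl_le (a b : nat -> R) y : (forall k, (k <= n)%N -> a k <= b k) ->
  h 0%N <= y <= h n -> pl a y <= pl b y.
Proof.
move=> ab /locate[->|[k kn [t t01 ->]]]; first by rewrite !pl_node // ab.
rewrite !pl_segment //; have := ab _ (ltnW kn); have := ab _ kn.
by case/andP: t01 => t0 t1; nra.
Qed.

Lemma pl_bounded (a : nat -> R) : exists M, forall y, `|pl a y| <= M.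
Proof.
exists (`|a 0%N| + \sum_(k < n) `|a k.+1 - a k|) => y.
apply: le_trans (ler_normD _ _) _; rewrite lerD2l.
apply: le_trans (ler_norm_sum _ _ _) _; apply: ler_sum => k _.
by rewrite normrM ler_piMr // clamp_norm_le1.
Qed.

Lemma pl_continuous (a : nat -> R) : continuous (pl a).
Proof.
move=> y; apply: cvgD; first exact: cvg_cst.
apply: cvg_big => [|k _]; first exact: add_continuous.
apply: cvgM; first exact: cvg_cst.
apply: (@continuous_comp _ _ _ (fun y => (y - h k) / (h k.+1 - h k)) clamp).
  apply: cvgM; last exact: cvg_cst.
  by apply: cvgB; [exact: cvg_id|exact: cvg_cst].
exact: clamp_continuous.
Qed.

(** * Bands between two piecewise linear functions, and the regions they fill *)

Definition band (l r : nat -> R) : set (R * R) :=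
  [set p | h 0%N <= p.2 <= h n /\ pl l p.2 <= p.1 <= pl r p.2].

Definition open_band (l r : nat -> R) : set (R * R) :=
  [set p | h 0%N < p.2 < h n /\ pl l p.2 < p.1 < pl r p.2].

Let fst_continuous : continuous (@fst R R).
Proof. by move=> p; exact: cvg_fst. Qed.

Let snd_continuous : continuous (@snd R R).
Proof. by move=> p; exact: cvg_snd. Qed.

Let pl_snd_continuous a : continuous (fun p : R * R => pl a p.2).
Proof.
move=> p; apply: (@continuous_comp _ _ _ snd (pl a)).
  exact: snd_continuous.
exact: pl_continuous.
Qed.

Let closed_le_fun (f g : R * R -> R) :
  continuous f -> continuous g -> closed [set p | f p <= g p].
Proof.
move=> cf cg.
have -> : [set p | f p <= g p] = (fun p => g p - f p) @^-1` [set x | 0 <= x].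
  by apply/seteqP; split => p /=; rewrite subr_ge0.
apply: preimage_closed; last exact: closed_ge.
by move=> p _; apply: cvgB; [exact: cg|exact: cf].
Qed.

Let open_lt_fun (f g : R * R -> R) :
  continuous f -> continuous g -> open [set p | f p < g p].
Proof.
move=> cf cg.
have -> : [set p | f p < g p] = (fun p => g p - f p) @^-1` [set x | 0 < x].
  by apply/seteqP; split => p /=; rewrite subr_gt0.
apply: open_comp; last exact: open_gt.
by move=> p _; apply: cvgB; [exact: cg|exact: cf].
Qed.

Lemma band_closed l r : closed (band l r).
Proof.
have -> : band l r =
    ([set p | h 0%N <= p.2] `&` [set p | p.2 <= h n]) `&`
    ([set p | pl l p.2 <= p.1] `&` [set p | p.1 <= pl r p.2]).
  by apply/seteqP; split => p [] => [/andP[? ?] /andP[? ?]|[? ?] [? ?]];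
     do 2?split => //=; apply/andP.
by do 2!apply: closedI; apply: closed_le_fun => //; move=> p; exact: cvg_cst.
Qed.

Lemma open_band_open l r : open (open_band l r).
Proof.
have -> : open_band l r =
    ([set p | h 0%N < p.2] `&` [set p | p.2 < h n]) `&`
    ([set p | pl l p.2 < p.1] `&` [set p | p.1 < pl r p.2]).
  by apply/seteqP; split => p [] => [/andP[? ?] /andP[? ?]|[? ?] [? ?]];
     do 2?split => //=; apply/andP.
by do 2!apply: openI; apply: open_lt_fun => //; move=> p; exact: cvg_cst.
Qed.

Lemma band_bounded l r : bounded_set (band l r).
Proof.
have [Ml Hl] := pl_bounded l; have [Mr Hr] := pl_bounded r.
exists (`|h 0%N| + `|h n| + Ml + Mr); split; first exact: num_real.
move=> M ltM p [/andP[y0 yn] /andP[xl xr]].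
rewrite /= prod_normE ge_max.
have := Hl p.2; have := Hr p.2; rewrite !ler_norml.
move=> /andP[r1 r2] /andP[l1 l2].
have := ler_norm (h n); have := ler_norm (- h 0%N); rewrite normrN.
have := normr_ge0 (h n); have := normr_ge0 (h 0%N).
by move=> *; apply/andP; split; apply/andP; split; lra.
Qed.

(** The horizontal half-line from [p] in direction [e] is connected and avoids [C], so the component
    of [p] contains it and is unbounded. *)
Lemma ray_escapes (C : set (R * R)) (p : R * R) (e : R) : `|e| = 1 ->
  (forall s, 0 <= s -> ~ C (p.1 + e * s, p.2)) ->
  ~ bounded_set (connected_component (~` C) p).
Proof.
move=> e1 pC /ex_strict_bound_gt0[M _ HM].
pose ray := [set (p.1 + e * s, p.2) | s in [set s : R | 0 <= s]].
have sub : ray `<=` connected_component (~` C) p.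
  apply: connected_component_max.
  - by exists 0; rewrite /= ?mulr0 ?addr0 //; case: p {pC HM ray}.
  - by move=> _ [s s0 <-]; exact: pC.
  - apply: connected_continuous_connected.
      apply/connected_intervalP => x y /= x0 y0 z /andP[xz _].
      exact: le_trans x0 xz.
    apply: continuous_subspaceT => s.
    have cx : p.1 + e * x @[x --> s] --> p.1 + e * s.
      apply: cvgD; first exact: cvg_cst.
      by apply: cvgM; [exact: cvg_cst|exact: cvg_id].
    have cy : p.2 @[x --> s] --> p.2 by exact: cvg_cst.
    exact: (cvg_pair cx cy).
(* At this parameter the abscissa has absolute value at least [|M| + 1], beyond the supposed
   bound. *)
have s0 : 0 <= `|M| + `|p.1| + 1 by rewrite !addr_ge0.
have rays : ray (p.1 + e * (`|M| + `|p.1| + 1), p.2)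
  by exists (`|M| + `|p.1| + 1).
have /= := HM _ (sub _ rays).
rewrite prod_normE gt_max /= => /andP[+ _].
set s := _ + 1 in s0 *.
have := ler_normD (p.1 + e * s) (- p.1); rewrite addrAC subrr add0r normrM e1.
rewrite mul1r normrN (ger0_norm s0) /s; have := ler_norm M; lra.
Qed.

(** Points outside the band escape horizontally. For a point of the band off [C], the band and the
    open band cut the same part out of its component; that part is closed, open and nonempty, hence
    the whole component, which is therefore bounded. *)
Lemma region_band (C : set (R * R)) l r :
  C `<=` band l r -> band l r `\` C `<=` open_band l r ->
  region C = band l r.
Proof.
move=> CT TU; apply/seteqP; split => p.
  case=> [/CT //|[pC bnd]]; apply: contrapT => pT.
  (* A point left of the left side escapes to the left. Any other point outside the band escapes to
     the right, including those above or below it. *)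
  have [|xl] := ltP p.1 (pl l p.2) => [xl|].
    apply: (@ray_escapes C p (-1)) bnd => [|s s0 /CT[_ /= /andP[+ _]]].
      by rewrite normrN1.
    lra.
  apply: (@ray_escapes C p 1) bnd => [|s s0 /CT[/= y /= /andP[_ xr]]].
    by rewrite normr1.
  by apply: pT; split=> //; rewrite xl /=; lra.
move=> pT; have [pC|pC] := pselect (C p); [by left|right; split=> //].
set A := connected_component _ _.
suff AT : A `<=` band l r.
  by apply: sub_boundedr (@band_bounded l r) => S /= TS x /AT; exact: TS.
have AC : A `<=` ~` C by exact: connected_component_sub.
have UT : open_band l r `<=` band l r.
  by move=> q [/andP[? ?] /andP[? ?]]; split; rewrite !ltW.
have EA : A `&` open_band l r = A `&` band l r.
  apply/seteqP; split=> q [Aq].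
    by move=> /UT.
  by move=> Tq; split=> //; apply: TU; split=> //; exact: AC.
have <- : A `&` open_band l r = A.
  apply: (@component_connected _ (~` C) p).
  - exists p; rewrite EA; split=> //; exact: connected_component_refl.
  - by exists (open_band l r) => //; exact: open_band_open.
  - by exists (band l r) => //; exact: band_closed.
by rewrite EA => q [].
Qed.

(** * Segments, and the trapezoid as a band *)

Lemma segmentC (p q : R * R) : segment p q = segment q p.
Proof.
suff S (u v : R * R) : segment u v `<=` segment v u by apply/seteqP; split.
move=> _ [t /= t01 <-]; move: t01; rewrite in_itv /= => /andP[t0 t1].
exists (1 - t); first by rewrite /= in_itv /=; apply/andP; split; lra.
by congr pair; ring.
Qed.

Lemma segment_horizontal (a b y : R) (p : R * R) : a <= b ->
  segment (a, y) (b, y) p <-> p.2 = y /\ a <= p.1 <= b.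
Proof.
move=> ab; split.
  case=> t /=; rewrite in_itv /= => /andP[t0 t1] <- /=.
  by split; [ring|apply/andP; split; nra].
case: p => x z /= [-> /andP[ax xb]].
(* A segment reduced to a point is treated apart, since the parameter below divides by [b - a]. *)
have [ba|ba] := ltP a b; last first.
  exists 0; rewrite /= ?in_itv /= ?lexx ?ler01 //.
  by congr pair; lra.
have ba0 : 0 < b - a by rewrite subr_gt0.
exists ((x - a) / (b - a)).
  rewrite /= in_itv /= divr_ge0 ?subr_ge0 ?(ltW ba) //=.
  by rewrite ler_pdivrMr // mul1r lerD2r.
by rewrite /=; congr pair; field; rewrite gt_eqF.
Qed.

Lemma pl_graph_segment (a : nat -> R) (k : nat) (p : R * R) : (k < n)%N ->
  segment (a k, h k) (a k.+1, h k.+1) p ->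
  h 0%N <= p.2 <= h n /\ p.1 = pl a p.2.
Proof.
move=> kn [t /=]; rewrite in_itv /= => t01 <- /=; split; last first.
  by rewrite pl_segment.
have h0 : h 0%N <= h k by rewrite h_le // leq0n ltnW.
have h1 : h k.+1 <= h n by rewrite h_le // kn leqnn.
have hk := h_lt kn.
by case/andP: t01 => t0 t1; apply/andP; split; nra.
Qed.

(** The sides of the polygon are the graphs of [pl l] and [pl r] and the two extreme horizontal
    intervals, so [region_band] applies. With [n.+1] lines there are [n] gaps between consecutive
    ones. *)
Lemma trapezoidE (l r : nat -> R) : (forall k, (k <= n)%N -> l k <= r k) ->
  @trapezoid R n.+1 h l r = band l r.
Proof.
move=> lr; have lrp := pl_le lr.
have h0n : h 0%N <= h n by rewrite h_le // leq0n leqnn.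
apply: region_band => p.
  case=> [[i [j [ij]]]|[i [iE]]|[i [j [ij]]]|[i [iE]]].
  - rewrite ij => /pl_graph_segment[|y xE]; first by rewrite -ltnS -ij.
    by split=> //; rewrite xE lexx lrp.
  - case: iE => ->; rewrite segment_horizontal ?lr // => -[yE x].
    by split; rewrite yE ?h0n ?lexx // !pl_node.
  - rewrite ij segmentC => /pl_graph_segment[|y xE]; first by rewrite -ltnS -ij.
    by split=> //; rewrite xE lexx lrp.
  - rewrite iE segmentC segment_horizontal ?lr // => -[yE x].
    by split; rewrite yE ?h0n ?lexx // !pl_node.
case=> -[yh xlr] pC.
(* Equality in any of the four inequalities defining the band would put the point on a side of the
   polygon. *)
have y0 : p.2 != h 0%N.
  apply/eqP => y0; apply: pC; apply: Or44; exists ord0; split=> //=.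
  by rewrite segmentC segment_horizontal ?lr //
    -(pl_node l) // -(pl_node r) // -y0.
have yn : p.2 != h n.
  apply/eqP => yn; apply: pC; apply: Or42; exists ord_max; split=> //=.
  by rewrite segment_horizontal ?lr // -(pl_node l) // -(pl_node r) // -yn.
have [yn'|[k kn [t t01 yE]]] := locate yh; first by rewrite yn' eqxx in yn.
have kS : (k < n.+1)%N by rewrite ltnS ltnW.
have seg a : p.1 = pl a p.2 -> segment (a k, h k) (a k.+1, h k.+1) p.
  rewrite yE pl_segment // => xE; exists t; first by rewrite /= in_itv.
  by rewrite /= -yE -xE; case: (p).
have xl : p.1 != pl l p.2.
  apply/eqP => xE; apply: pC; apply: Or41.
  exists (Ordinal kS), (Ordinal (kn : (k.+1 < n.+1)%N)); split=> //.
  exact: seg.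
have xr : p.1 != pl r p.2.
  apply/eqP => xE; apply: pC; apply: Or43.
  exists (Ordinal kS), (Ordinal (kn : (k.+1 < n.+1)%N)); split=> //.
  by rewrite segmentC; exact: seg.
move: yh xlr => /andP[y1 y2] /andP[x1 x2]; split; rewrite !lt_neqAle.
  by rewrite eq_sym y0 y1 yn y2.
by rewrite eq_sym xl x1 xr x2.
Qed.

(** * Intersection of two bands *)

Lemma bands_crossing (l r l' r' : nat -> R) k :
  (forall k, (k <= n)%N -> l k <= r k) ->
  (forall k, (k <= n)%N -> l' k <= r' k) ->
  (k < n)%N -> r k < l' k -> r' k.+1 < l k.+1 ->
  band l r `&` band l' r' !=set0.
Proof.
move=> lr lr' kn c0 c1.
have a0 : 0 < l' k - r k by rewrite subr_gt0.
have b0 : 0 < r k.+1 - l' k.+1.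
  by have := lr _ kn; have := lr' _ kn; lra.
(* The zero of the affine function [(1 - t) * (r k - l' k) + t * (r k.+1 - l' k.+1)]: there the
   right side of the first band meets the left side of the second. *)
pose t := (l' k - r k) / ((l' k - r k) + (r k.+1 - l' k.+1)).
have ab0 := addr_gt0 a0 b0.
have t01 : 0 <= t <= 1.
  rewrite /t (divr_ge0 (ltW a0) (ltW ab0)) /= ler_pdivrMr // mul1r.
  by rewrite lerDl ltW.
have tE : (1 - t) * r k + t * r k.+1 = (1 - t) * l' k + t * l' k.+1.
  by rewrite /t; field; rewrite gt_eqF.
pose p := ((1 - t) * r k + t * r k.+1, (1 - t) * h k + t * h k.+1).
have [yh xr] : h 0%N <= p.2 <= h n /\ p.1 = pl r p.2.
  by apply: (pl_graph_segment kn); exists t; rewrite /= ?in_itv.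
have xl' : p.1 = pl l' p.2 by rewrite /= pl_segment.
exists p; split; split=> //.
  by rewrite xr lexx andbT pl_le.
by rewrite xl' lexx pl_le.
Qed.

Lemma bands_disjoint (l r l' r' : nat -> R) :
  (forall k, (k <= n)%N -> r k < l' k) -> band l r `&` band l' r' = set0.
Proof.
move=> rl; apply/seteqP; split=> // p [[yh /andP[_ xr]] [_ /andP[xl' _]]].
by have := pl_lt rl yh; lra.
Qed.

Lemma bands_meet (l r l' r' : nat -> R) :
  (forall k, (k <= n)%N -> l k <= r k) ->
  (forall k, (k <= n)%N -> l' k <= r' k) ->
  band l r `&` band l' r' !=set0 <->
  meet n (fun k => l k <= r' k) (fun k => l' k <= r k).
Proof.
move=> lr lr'; split; last first.
  case=> [[k kn /andP[lr1 lr2]]|[k kn]]; last first.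
    rewrite -!ltNge => /orP[] /andP[c0 c1].
      exact: (bands_crossing lr lr' kn).
    by rewrite setIC; exact: (bands_crossing lr' lr kn).
  (* The larger of the two left ends lies in both intervals. *)
  exists (Num.max (l k) (l' k), h k); have := lr _ kn; have := lr' _ kn.
  have h0 : h 0%N <= h k by rewrite h_le // leq0n.
  have h1 : h k <= h n by rewrite h_le // kn leqnn.
  move=> kr' kr; split; split=> /=; rewrite ?h0 ?h1 // !pl_node //.
    by rewrite le_max ge_max lexx kr lr2.
  by rewrite le_max ge_max lexx orbT kr' lr1.
move=> ne; apply: contrapT => nm; move: ne; apply/nonemptyPn.
have disj k : (k <= n)%N -> r k < l' k \/ r' k < l k.
  move=> kn; have [|lr1] := ltP (r k) (l' k); [by left|].
  have [|lr2] := ltP (r' k) (l k); first by right.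
  by case: nm; left; exists k; rewrite ?lr1 ?lr2.
have [rl0|rl0] := disj 0%N (leq0n _).
  apply: bands_disjoint; elim=> // k IH kn.
  have [//|c] := disj _ kn; case: nm; right; exists k => //.
  by rewrite -!ltNge (IH (ltnW kn)) c.
rewrite setIC; apply: bands_disjoint; elim=> // k IH kn.
have [c|//] := disj _ kn; case: nm; right; exists k => //.
by rewrite -!ltNge (IH (ltnW kn)) c orbT.
Qed.

End PiecewiseLinear.

(** The heights are extended to all natural numbers through [inord], to match the functions on
    naturals used for bands. *)
Lemma trapezoids_meet (R : realType) (n : nat) (h : 'I_n.+1 -> R)
    (l r l' r' : nat -> R) :
  (forall i j : 'I_n.+1, (i < j)%N -> h i < h j) ->
  (forall k, (k <= n)%N -> l k <= r k) ->
  (forall k, (k <= n)%N -> l' k <= r' k) ->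
  trapezoid h (fun i => l i) (fun i => r i) `&`
    trapezoid h (fun i => l' i) (fun i => r' i) !=set0 <->
  meet n (fun k => l k <= r' k) (fun k => l' k <= r k).
Proof.
move=> h_incr lr lr'; pose H k := h (inord k).
have hE : h = (fun i : 'I_n.+1 => H i)
  by apply/funext => i; rewrite /H inord_val.
have H_lt k : (k < n)%N -> H k < H k.+1.
  by move=> kn; apply: h_incr; rewrite !inordK // ltnS ltnW.
by rewrite hE !(trapezoidE H_lt) //; exact: bands_meet.
Qed.

Lemma trapezoid_graph_isomorphic (R : realType) (d : nat) (h : 'I_d -> R)
    (G H : sgraph) :
  isomorphic G H -> trapezoid_graph h H -> trapezoid_graph h G.
Proof.
move=> [f [bf fE]] [l [r [lr HE]]].
exists (l \o f), (r \o f); split=> [v i|u v uv]; first exact: lr.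
by rewrite -fE; apply: HE; rewrite (inj_eq (bij_inj bf)).
Qed.

(** * Positions of occurrences in a word *)

Section Words.
Local Open Scope nat_scope.

Lemma uniq_sorted_index (T : eqType) (s : seq T) :
  uniq s -> sorted (relpre (index^~ s) ltn) s.
Proof.
case Es: s => [|x s'] //; rewrite -Es => us; apply/(sortedP x) => i lt_i.
by rewrite /= !index_uniq // ltnW.
Qed.

Lemma count_mem_rcons (T : eqType) (w : seq T) x a :
  count_mem a (rcons w x) = count_mem a w + (x == a).
Proof. by rewrite -cats1 count_cat /= addn0. Qed.

(** * Words with numbered occurrences *)

Section LabelledOccurrences.
Variable A : eqType.
Implicit Types (w : seq A) (a b x : A).

(** Numbers equal letters starting from the end. [lab] applies it to the mirror image, so that
    [(a, k)] stands for the k-th occurrence of [a] and appending a letter appends one pair. *)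
Fixpoint rlab (s : seq A) : seq (A * nat) :=
  if s is x :: s' then (x, (count_mem x s').+1) :: rlab s' else [::].

Definition lab w : seq (A * nat) := rev (rlab (rev w)).

Lemma lab_rcons w x : lab (rcons w x) = rcons (lab w) (x, (count_mem x w).+1).
Proof. by rewrite /lab rev_rcons /= rev_cons count_rev. Qed.

Lemma mem_lab w a k : ((a, k) \in lab w) = (0 < k <= count_mem a w).
Proof.
elim/last_ind: w => [|w x IH]; first by case: k.
rewrite lab_rcons mem_rcons inE IH count_mem_rcons xpair_eqE eq_sym.
by case: eqVneq => [->|_] /=; [lia|rewrite addn0].
Qed.

Lemma lab_uniq w : uniq (lab w).
Proof.
elim/last_ind: w => [|w x IH] //.
by rewrite lab_rcons rcons_uniq IH mem_lab ltnn andbF.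
Qed.

(** Positions start at 0; a missing occurrence gets the length of the word. *)
Definition pos w a k := index (a, k) (lab w).

Lemma pos_lt w a j k : 0 < j -> j < k -> k <= count_mem a w ->
  pos w a j < pos w a k.
Proof.
rewrite /pos; elim/last_ind: w => [|w x IH] j0 jk; first by rewrite /=; lia.
rewrite count_mem_rcons lab_rcons -cats1 !index_cat !mem_lab => kc.
have -> : 0 < j <= count_mem a w by lia.
case: ifP => [/andP[_ kw]|_]; first exact: IH.
by apply: ltn_addr; rewrite index_mem mem_lab; lia.
Qed.

Lemma pos_inj w a b j k : 0 < j <= count_mem a w ->
  pos w a j = pos w b k -> a = b.
Proof.
rewrite -mem_lab => aj E; have := nth_index (a, j) aj.
rewrite -/(pos w a j) E nth_index; first by case.
by rewrite -index_mem -/(pos w b k) -E index_mem.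
Qed.

Lemma count_mem_proj_false w a b :
  count_mem false (proj_word a b w) = count_mem a w.
Proof.
elim: w => //= x w <-; case: eqVneq => [|_] //=.
by case: eqVneq.
Qed.

Lemma count_mem_proj_true w a b : a != b ->
  count_mem true (proj_word a b w) = count_mem b w.
Proof.
by move=> ab; rewrite -(count_mem_proj_false w b a)
  (proj_word_exchange _ ab) count_mem_negb.
Qed.

(** An appended letter leaves the ranks of the earlier ones unchanged, which allows induction from
    the right. *)
Lemma keep_occ_rcons K (w : seq bool) c :
  keep_occ K (rcons w c) =
  keep_occ K w ++ (if K (count_mem c w).+1 then [:: c] else [::]).
Proof.
rewrite /keep_occ size_rcons -addn1 iotaD filter_cat map_cat add0n.
congr (_ ++ _).
  have E p : p \in iota 0 (size w) -> nth false (rcons w c) p = nth false w p.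
    by rewrite mem_iota nth_rcons /= => ->.
  rewrite (@eq_in_filter _ _ (fun p => K (occ_index w p))); last first.
    move=> p ip; rewrite /occ_index E // -cats1 takel_cat //.
    by move: ip; rewrite mem_iota.
  by apply/eq_in_map => p; rewrite mem_filter => /andP[_ /E].
rewrite /= /occ_index nth_rcons ltnn eqxx -(size_rcons w c) take_size.
by rewrite count_mem_rcons eqxx addn1; case: ifP => //= _;
  rewrite nth_rcons ltnn eqxx.
Qed.

(** Projection preserves the order of the letters [a] and [b] and their ranks, so selecting by rank
    can be done on the labelled word. *)
Lemma keep_occ_proj K a b w : a != b ->
  keep_occ K (proj_word a b w) =
  [seq e.1 == b | e <- lab w & ((e.1 == a) || (e.1 == b)) && K e.2].
Proof.
move=> ab; elim/last_ind: w => [|w x IH] //.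
rewrite lab_rcons -!cats1 filter_cat map_cat -IH /proj_word pmap_cat /=.
rewrite -/(proj_word a b w); case: (eqVneq x a) => [->|xa] /=.
  rewrite cats1 keep_occ_rcons count_mem_proj_false.
  by case: (K _) => //=; rewrite (negbTE ab).
case: (eqVneq x b) => [->|xb] /=; last by rewrite !cats0.
rewrite cats1 keep_occ_rcons count_mem_proj_true //.
by case: (K _) => //=; rewrite eqxx.
Qed.

Definition pos_ltn w : rel (A * nat) :=
  fun e f => pos w e.1 e.2 < pos w f.1 f.2.

(** A list sorted for a strict order is determined by its members; it thus suffices to exhibit the
    kept occurrences in increasing position. *)
Lemma keep_occ_sorted K a b w s : a != b -> sorted (pos_ltn w) s ->
  (forall e, (e \in s) =
     ((e.1 == a) || (e.1 == b)) && K e.2 && (0 < e.2 <= count_mem e.1 w)) ->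
  keep_occ K (proj_word a b w) = [seq e.1 == b | e <- s].
Proof.
move=> ab ss es; rewrite keep_occ_proj //; congr map.
have tr : transitive (pos_ltn w) by move=> x y z; apply: ltn_trans.
apply: (irr_sorted_eq tr) ss _ => [x||e]; first by rewrite /pos_ltn ltnn.
  apply: (sorted_filter tr); apply: sub_sorted (uniq_sorted_index (lab_uniq w)).
  by move=> [x j] [y k].
by rewrite mem_filter es; case: e => x k; rewrite mem_lab.
Qed.

(** Labels that read 1, 2, 3, ... along each letter are the ranks. This recovers labelled events
    from the bare word of their letters. *)
Lemma lab_map_fst (E : seq (A * nat)) :
  (forall a, [seq e.2 | e <- E & e.1 == a] =
             iota 1 (count (fun e => e.1 == a) E)) ->
  lab (map fst E) = E.
Proof.
elim/last_ind: E => [|E [x k] IH] // HE; rewrite map_rcons lab_rcons /=.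
have HS a : [seq e.2 | e <- E & e.1 == a] ++ (if x == a then [:: k] else [::]) =
    iota 1 (count (fun e => e.1 == a) E) ++
    (if x == a then [:: (count (fun e => e.1 == a) E).+1] else [::]).
  have := HE a; rewrite -cats1 filter_cat map_cat count_cat /=.
  by case: eqP => _ /= ->; rewrite ?addn0 ?cats0 // iotaD.
rewrite IH => [|a].
  have := HS x; rewrite eqxx !cats1 => /rcons_inj[_ ->].
  by rewrite count_map.
by have := HS a; case: eqP => _; rewrite ?cats0 // !cats1 => /rcons_inj[].
Qed.

(** * The patterns of the language in terms of positions *)

Section TrapezoidLanguage.
Variables (w : seq A) (a b : A) (d i : nat).
Hypotheses (ab : a != b) (lt_id : i < d).
Hypotheses (ca : count_mem a w = 2 * d) (cb : count_mem b w = 2 * d).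

Let P := pos w.

(** Here [i] counts lines from 0, so [delta i.+1] keeps occurrences [2 * i + 1] and [2 * i + 2]. *)
Lemma delta_sorted s : sorted (pos_ltn w) s ->
  s =i [:: (a, (2 * i).+1); (a, (2 * i).+2); (b, (2 * i).+1); (b, (2 * i).+2)] ->
  delta i.+1 (proj_word a b w) = [seq e.1 == b | e <- s].
Proof.
move=> ss es; apply: keep_occ_sorted => // -[x k];
  rewrite es !inE !xpair_eqE /=.
case: (eqVneq x a) => [->|xa] /=; first by rewrite ca (negbTE ab) /=; lia.
by case: (eqVneq x b) => [->|xb] /=; first by rewrite cb; lia.
Qed.

Lemma delta4_sorted s : i.+1 < d -> sorted (pos_ltn w) s ->
  s =i [:: (a, (2 * i).+1); (a, (2 * i).+2); (a, (2 * i).+3); (a, (2 * i).+4);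
           (b, (2 * i).+1); (b, (2 * i).+2); (b, (2 * i).+3); (b, (2 * i).+4)] ->
  delta4 i.+1 (proj_word a b w) = [seq e.1 == b | e <- s].
Proof.
move=> lt_id' ss es; apply: keep_occ_sorted => // -[x k];
  rewrite es !inE !xpair_eqE /=.
case: (eqVneq x a) => [->|xa] /=; first by rewrite ca (negbTE ab) /=; lia.
by case: (eqVneq x b) => [->|xb] /=; first by rewrite cb; lia.
Qed.

Let pos_ltS c j :
  count_mem c w = 2 * d -> 0 < j -> j < 2 * d -> P c j < P c j.+1.
Proof. by move=> cE j0 jd; apply: pos_lt; rewrite ?cE. Qed.

Let pos_neq j k : 0 < j <= 2 * d -> P a j != P b k.
Proof. by rewrite -ca => jd; apply: contra ab => /eqP/(pos_inj jd)/eqP. Qed.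

Local Notation a1 := (a, (2 * i).+1).
Local Notation a2 := (a, (2 * i).+2).
Local Notation a3 := (a, (2 * i).+3).
Local Notation a4 := (a, (2 * i).+4).
Local Notation b1 := (b, (2 * i).+1).
Local Notation b2 := (b, (2 * i).+2).
Local Notation b3 := (b, (2 * i).+3).
Local Notation b4 := (b, (2 * i).+4).

Ltac by_order4 s :=
  rewrite (@delta_sorted s);
  [ by rewrite /= (negbTE ab) eqxx
  | by rewrite /= /pos_ltn /= -/P; lia
  | by move=> ?; rewrite !inE; do 4![case: (_ == _)] ].

Ltac by_order8 s :=
  rewrite (@delta4_sorted s);
  [ by rewrite /= (negbTE ab) eqxx
  | by []
  | by rewrite /= /pos_ltn /= -/P; lia
  | by move=> ?; rewrite !inE; do 8![case: (_ == _)] ].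

(** Two pairs interleave in six ways; the four listed words are all but 0011 and 1100, the orders of
    disjoint intervals. *)
Lemma delta_overlap :
  (delta i.+1 (proj_word a b w) \in
     [:: [:: false; true; false; true]; [:: true; false; true; false];
         [:: false; true; true; false]; [:: true; false; false; true]]) =
  (P a (2 * i).+1 <= P b (2 * i).+2) && (P b (2 * i).+1 <= P a (2 * i).+2).
Proof.
have a12 : P a (2 * i).+1 < P a (2 * i).+2 by apply: pos_ltS; lia.
have b12 : P b (2 * i).+1 < P b (2 * i).+2 by apply: pos_ltS; lia.
have n11 : P a (2 * i).+1 != P b (2 * i).+1 by apply: pos_neq; lia.
have n12 : P a (2 * i).+1 != P b (2 * i).+2 by apply: pos_neq; lia.
have n21 : P a (2 * i).+2 != P b (2 * i).+1 by apply: pos_neq; lia.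
have n22 : P a (2 * i).+2 != P b (2 * i).+2 by apply: pos_neq; lia.
case: (leqP (P a (2 * i).+1) (P b (2 * i).+2)) => ab12 /=; last first.
  by_order4 [:: b1; b2; a1; a2].
case: (leqP (P b (2 * i).+1) (P a (2 * i).+2)) => ba12 /=; last first.
  by_order4 [:: a1; a2; b1; b2].
case: (leqP (P a (2 * i).+1) (P b (2 * i).+1)) => ab11;
  case: (leqP (P a (2 * i).+2) (P b (2 * i).+2)) => ab22.
- by_order4 [:: a1; b1; a2; b2].
- by_order4 [:: a1; b1; b2; a2].
- by_order4 [:: b1; a1; a2; b2].
- by_order4 [:: b1; a1; b2; a2].
Qed.

(** The two implications say that the intervals are disjoint on both lines; each comparison in the
    conclusion then tells whether [b] is on the left. *)
Lemma delta4_crossing : i.+1 < d ->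
  (P b (2 * i).+1 <= P a (2 * i).+2 -> P b (2 * i).+2 < P a (2 * i).+1) ->
  (P b (2 * i).+3 <= P a (2 * i).+4 -> P b (2 * i).+4 < P a (2 * i).+3) ->
  (delta4 i.+1 (proj_word a b w) \in
     [:: [:: false; false; true; true; true; true; false; false];
         [:: true; true; false; false; false; false; true; true]]) =
  ((P b (2 * i).+1 <= P a (2 * i).+2) != (P b (2 * i).+3 <= P a (2 * i).+4)).
Proof.
move=> lt_id'.
have a12 : P a (2 * i).+1 < P a (2 * i).+2 by apply: pos_ltS; lia.
have a23 : P a (2 * i).+2 < P a (2 * i).+3 by apply: pos_ltS; lia.
have a34 : P a (2 * i).+3 < P a (2 * i).+4 by apply: pos_ltS; lia.
have b12 : P b (2 * i).+1 < P b (2 * i).+2 by apply: pos_ltS; lia.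
have b23 : P b (2 * i).+2 < P b (2 * i).+3 by apply: pos_ltS; lia.
have b34 : P b (2 * i).+3 < P b (2 * i).+4 by apply: pos_ltS; lia.
have n13 : P a (2 * i).+1 != P b (2 * i).+3 by apply: pos_neq; lia.
have n14 : P a (2 * i).+1 != P b (2 * i).+4 by apply: pos_neq; lia.
have n23 : P a (2 * i).+2 != P b (2 * i).+3 by apply: pos_neq; lia.
have n24 : P a (2 * i).+2 != P b (2 * i).+4 by apply: pos_neq; lia.
have n31 : P a (2 * i).+3 != P b (2 * i).+1 by apply: pos_neq; lia.
have n32 : P a (2 * i).+3 != P b (2 * i).+2 by apply: pos_neq; lia.
have n41 : P a (2 * i).+4 != P b (2 * i).+1 by apply: pos_neq; lia.
have n42 : P a (2 * i).+4 != P b (2 * i).+2 by apply: pos_neq; lia.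
case: (leqP (P b (2 * i).+1) (P a (2 * i).+2)) => [_ /(_ isT) d1|d1 _];
  case: (leqP (P b (2 * i).+3) (P a (2 * i).+4)) => [_ /(_ isT) d2|d2 _] /=.
(* With [b] on the left twice, the word begins with 11 and ends with 00, unlike both patterns; six
   interleavings are possible in between. *)
- case: (leqP (P a (2 * i).+1) (P b (2 * i).+3)) => c13;
    case: (leqP (P a (2 * i).+2) (P b (2 * i).+3)) => c23;
    case: (leqP (P a (2 * i).+1) (P b (2 * i).+4)) => c14;
    case: (leqP (P a (2 * i).+2) (P b (2 * i).+4)) => c24; try lia.
  + by_order8 [:: b1; b2; a1; a2; b3; b4; a3; a4].
  + by_order8 [:: b1; b2; a1; b3; a2; b4; a3; a4].
  + by_order8 [:: b1; b2; a1; b3; b4; a2; a3; a4].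
  + by_order8 [:: b1; b2; b3; a1; a2; b4; a3; a4].
  + by_order8 [:: b1; b2; b3; a1; b4; a2; a3; a4].
  + by_order8 [:: b1; b2; b3; b4; a1; a2; a3; a4].
(* When the sides differ, the order of all eight occurrences is forced. *)
- by_order8 [:: b1; b2; a1; a2; a3; a4; b3; b4].
- by_order8 [:: a1; a2; b1; b2; b3; b4; a3; a4].
- case: (leqP (P b (2 * i).+1) (P a (2 * i).+3)) => c13;
    case: (leqP (P b (2 * i).+2) (P a (2 * i).+3)) => c23;
    case: (leqP (P b (2 * i).+1) (P a (2 * i).+4)) => c14;
    case: (leqP (P b (2 * i).+2) (P a (2 * i).+4)) => c24; try lia.
  + by_order8 [:: a1; a2; b1; b2; a3; a4; b3; b4].
  + by_order8 [:: a1; a2; b1; a3; b2; a4; b3; b4].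
  + by_order8 [:: a1; a2; b1; a3; a4; b2; b3; b4].
  + by_order8 [:: a1; a2; a3; b1; b2; a4; b3; b4].
  + by_order8 [:: a1; a2; a3; b1; a4; b2; b3; b4].
  + by_order8 [:: a1; a2; a3; a4; b1; b2; b3; b4].
Qed.

End TrapezoidLanguage.

End LabelledOccurrences.

Definition lpos (A : eqType) (w : seq A) (a : A) (k : nat) := pos w a (2 * k).+1.
Definition rpos (A : eqType) (w : seq A) (a : A) (k : nat) := pos w a (2 * k).+2.

(** An overlap on some line is settled by [delta_overlap]; if there is none, the intervals are
    disjoint on every line and [delta4_crossing] applies. *)
Lemma trap_pred_proj (A : eqType) (w : seq A) (a b : A) (n : nat) : a != b ->
  count_mem a w = 2 * n.+1 -> count_mem b w = 2 * n.+1 ->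
  trap_pred n.+1 (proj_word a b w) <->
  meet n (fun k => lpos w a k <= rpos w b k) (fun k => lpos w b k <= rpos w a k).
Proof.
move=> ab ca cb; rewrite /trap_pred count_mem_proj_false count_mem_proj_true //.
rewrite ca cb eqxx !andTb -pred_Sn.
have overlap k : k <= n -> _ := fun kn => delta_overlap ab (kn : k < n.+1) ca cb.
have crossing k : k < n -> _ := fun kn =>
  delta4_crossing ab (ltnW kn : k < n.+1) ca cb kn.
have eqS k : (2 * k.+1 = (2 * k).+2) by rewrite mulnS.
have lt_lr c k : count_mem c w = 2 * n.+1 -> k <= n -> lpos w c k < rpos w c k.
  by move=> cE kn; apply: pos_lt; rewrite ?cE; lia.
split=> [|[[k kn]|[k kn]]].
- have [[k kn H] _|no] := pselect (exists2 k, k <= n &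
      (lpos w a k <= rpos w b k) && (lpos w b k <= rpos w a k)).
    by left; exists k.
  have disj k : k <= n -> lpos w b k <= rpos w a k -> rpos w b k < lpos w a k.
    by move=> kn ba; rewrite ltnNge; apply/negP => H; apply: no; exists k; rewrite ?H.
  move=> /orP[] /hasP[] [|k]; rewrite mem_iota //= => kn.
    by rewrite overlap // => H; case: no; exists k.
  have disjk := disj k (ltnW kn); have := disj k.+1 kn.
  rewrite {1}/lpos {1}/rpos /lpos /rpos eqS => disjS; rewrite crossing //.
  move=> c; right; exists k => //; move: c (disj k (ltnW kn)) (disj k.+1 kn).
  rewrite /lpos /rpos eqS; lia.
- by move=> H; apply/orP; left; apply/hasP; exists k.+1; rewrite ?mem_iota ?overlap.
(* An exchange already makes the intervals disjoint on both lines, as [crossing] requires. *)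
move=> H; apply/orP; right; apply/hasP; exists k.+1; first by rewrite mem_iota.
have := lt_lr _ _ ca (ltnW kn); have := lt_lr _ _ ca kn.
have := lt_lr _ _ cb (ltnW kn); have := lt_lr _ _ cb kn.
by rewrite crossing //; move: H; rewrite /lpos /rpos eqS; lia.
Qed.

Lemma size_lab (A : eqType) (w : seq A) : size (lab w) = size w.
Proof. by elim/last_ind: w => // w x IH; rewrite lab_rcons !size_rcons IH. Qed.

Lemma pos_lt_size (A : eqType) (w : seq A) (a : A) (k : nat) :
  0 < k <= count_mem a w -> pos w a k < size w.
Proof. by rewrite -size_lab -mem_lab index_mem. Qed.

End Words.

(** * From words to trapezoids and back *)

Section WordToTrapezoids.
Variables (R : realType) (n : nat) (A : choiceType) (w : seq A).

Let full (v : A) := count_mem v w == (2 * n.+1)%N.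

(* A letter that does not occur [2 * n.+1] times is an isolated vertex: it gets a
   vertical segment of its own, to the right of everything else. *)
Definition left_end (v : A) (k : nat) : nat :=
  if full v then lpos w v k else (size w + index v w)%N.
Definition right_end (v : A) (k : nat) : nat :=
  if full v then rpos w v k else (size w + index v w)%N.

Lemma left_right_end v k : (k <= n)%N -> (left_end v k <= right_end v k)%N.
Proof.
move=> kn; rewrite /left_end /right_end; case: ifP => // /eqP cv.
by apply/ltnW/pos_lt; rewrite ?cv; lia.
Qed.

(** The segment of [v] is to the right of [u] on every line: ends of full letters are below
    [size w], and the other letters are ordered by first occurrence. *)
Lemma isolated_not_meet u v :
  ~~ full v -> full u || (index u w < index v w)%N ->
  ~ meet n (fun k => left_end u k <= right_end v k)%N
           (fun k => left_end v k <= right_end u k)%N.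
Proof.
move=> nv uv_lt; apply: not_meet => k kn.
have := left_right_end u kn; have := left_right_end v kn.
suff : (right_end u k < left_end v k)%N by lia.
rewrite /right_end /left_end (negbTE nv); case: ifP uv_lt => [/eqP cu _|_ /= lt_uv].
  by apply: ltn_addr; apply: pos_lt_size; rewrite cu; lia.
by rewrite ltn_add2l.
Qed.

Lemma word_trap_edge u v : u \in w -> v \in w -> u != v ->
  trap_pred n.+1 (proj_word u v w) <->
  meet n (fun k => left_end u k <= right_end v k)%N
         (fun k => left_end v k <= right_end u k)%N.
Proof.
move=> uw vw uv; have [/andP[cu cv]|] := boolP (full u && full v).
  rewrite /left_end /right_end cu cv.
  by rewrite (trap_pred_proj uv (eqP cu) (eqP cv)).
(* If one letter is not full, uniformity rules out membership in the language and the isolated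
   segment rules out a meeting. *)
move=> nuv; split=> [/and3P[]|].
  rewrite count_mem_proj_false count_mem_proj_true // => cu cv.
  by move: nuv; rewrite /full cu cv.
have iuv : index u w != index v w.
  by apply: contra uv => /eqP/index_inj->.
move=> m; exfalso; move: m.
have [fv|nv] := boolP (full v).
  have nu : ~~ full u by move: nuv; rewrite fv andbT.
  by rewrite meetC; apply: isolated_not_meet; rewrite ?fv.
have [fu|nu] := boolP (full u); first by apply: isolated_not_meet; rewrite ?fu.
case: (ltngtP (index u w) (index v w)) iuv => // lt_uv _.
  by apply: isolated_not_meet; rewrite ?lt_uv ?orbT.
by rewrite meetC; apply: isolated_not_meet; rewrite ?lt_uv ?orbT.
Qed.

Lemma word_graph_trapezoid (h : 'I_n.+1 -> R) :
  (forall i j : 'I_n.+1, (i < j)%N -> h i < h j) ->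
  trapezoid_graph h (word_graph (Ltrap n.+1) w).
Proof.
move=> h_incr.
exists (fun v i => (left_end (val v) i)%:R), (fun v i => (right_end (val v) i)%:R).
split=> [v i|u v uv]; first by rewrite ler_nat left_right_end // -ltnS.
rewrite (@trapezoids_meet _ _ _ (fun k => (left_end (val u) k)%:R)
  (fun k => (right_end (val u) k)%:R) (fun k => (left_end (val v) k)%:R)
  (fun k => (right_end (val v) k)%:R)) //; last 2 first.
- by move=> k kn; rewrite ler_nat left_right_end.
- by move=> k kn; rewrite ler_nat left_right_end.
rewrite /= /word_edge uv /= word_trap_edge ?(valP u) ?(valP v) //.
by apply: eq_meet => k _; rewrite ler_nat.
Qed.

End WordToTrapezoids.

(** * The word of a family of trapezoids *)

Section TrapezoidsToWord.
Variables (R : realType) (n : nat) (V : finType) (l r : V -> nat -> R).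
Hypothesis lr : forall v k, (k <= n)%N -> l v k <= r v k.

(* The events [(v, 2k+1)] and [(v, 2k+2)] are the left and right ends of [v] on
   line [k]. Sorting by line, then abscissa, with left ends first among equal
   abscissas, makes closed intervals that touch overlap in the word. *)
Definition event_key (e : V * nat) : nat *l (R *l bool) :=
  let k := e.2.-1./2 in
  (k, ((if odd e.2 then l e.1 k else r e.1 k), ~~ odd e.2)).

Definition event_le : rel (V * nat) :=
  fun e f => (event_key e <= event_key f)%O.

Definition events : seq (V * nat) :=
  sort event_le [seq (v, k) | v <- enum V, k <- iota 1 (2 * n.+1)%N].

Definition event_word : seq V := map fst events.

Let event_le_trans : transitive event_le.
Proof. by move=> y x z; exact: le_trans. Qed.

Lemma events_sorted : sorted event_le events.
Proof. by apply: sort_sorted => x y; exact: le_total. Qed.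

Lemma events_uniq : uniq events.
Proof.
rewrite sort_uniq; apply: allpairs_uniq; rewrite ?enum_uniq ?iota_uniq //.
by move=> [? ?] [? ?] _ _ [-> ->].
Qed.

Lemma mem_events v k : ((v, k) \in events) = (0 < k <= 2 * n.+1)%N.
Proof.
rewrite mem_sort; apply/allpairsP/idP => [[e [_ + [_ ->]]]|kn].
  by rewrite mem_iota add1n ltnS.
exists (v, k); split=> //; first by rewrite mem_enum.
by rewrite mem_iota add1n ltnS.
Qed.

(** Only a strict comparison of keys is used, since it alone fixes the order after sorting. *)
Lemma event_index_lt e f : e \in events -> f \in events ->
  (event_key e < event_key f)%O -> (index e events < index f events)%N.
Proof.
move=> ee fe; apply: contraTT; rewrite -leqNgt -leNgt => fe_le.
have event_le_refl : reflexive event_le by move=> x; exact: le_refl.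
exact: (sorted_leq_index event_le_trans event_le_refl events_sorted _ _ fe ee).
Qed.

Lemma event_key_lt v j k : (0 < j)%N -> (j < k)%N -> (k <= 2 * n.+1)%N ->
  (event_key (v, j) < event_key (v, k))%O.
Proof.
move=> j0 jk kn; rewrite /event_key ltxi_pair /= ltxi_pair /= !leEnat.
have -> /= : (j.-1./2 <= k.-1./2)%N by lia.
apply/implyP => kj; have E : j.-1./2 = k.-1./2 by lia.
(* On a common line, [j] must be the left end and [k] the right end; the boolean component decides
   when they coincide. *)
have [-> ->] : odd j /\ odd k = false by split; lia.
by rewrite /= E lr ?implybT //; lia.
Qed.

(** Keys increase strictly with the labels of a vertex, so sorting lists these labels as 1, 2, ...
    and they agree with the ranks. *)
Lemma lab_event_word : lab event_word = events.
Proof.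
apply: lab_map_fst => v.
have E : [seq e.2 | e <- events & e.1 == v] = iota 1 (2 * n.+1)%N.
  apply: (irr_sorted_eq ltn_trans ltnn _ (iota_ltn_sorted _ _)) => [|k].
    rewrite ltn_sorted_uniq_leq map_inj_in_uniq ?filter_uniq ?events_uniq //=.
      rewrite sorted_map.
      apply: (@sub_in_sorted _ [pred e | (e.1 == v) && (e \in events)] event_le).
      - move=> [x j] [y k] /andP[/= /eqP -> je] /andP[/= /eqP -> ke].
        move: je ke; rewrite !mem_events => /andP[j0 jn] /andP[k0 kn] jk /=.
        rewrite leqNgt; apply/negP => kj.
        by have := event_key_lt v k0 kj jn; rewrite ltNge -/(event_le _ _) jk.
      - by apply/allP => e; rewrite mem_filter.
      - by apply: sorted_filter event_le_trans _ _ events_sorted.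
    move=> [x j] [y k]; rewrite !mem_filter => /andP[/= /eqP -> _].
    by move=> /andP[/= /eqP -> _] ->.
  rewrite mem_iota add1n ltnS -(mem_events v).
  apply/mapP/idP => [[[x j]]|ke]; last by exists (v, k); rewrite ?mem_filter /= ?eqxx.
  by rewrite mem_filter => /andP[/= /eqP -> je] ->.
by rewrite -size_filter -(size_map snd) E size_iota.
Qed.

(** The label [2 * n.+1] is present and its successor is absent. *)
Lemma count_event_word v : count_mem v event_word = (2 * n.+1)%N.
Proof.
have := mem_lab event_word v (2 * n.+1); have := mem_lab event_word v (2 * n.+1).+1.
by rewrite lab_event_word !mem_events; lia.
Qed.

(** When [l u k = r v k] the left end comes first, so weak inequality of abscissas becomes weak
    inequality of positions. *)
Lemma event_word_le u v k : (k <= n)%N ->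
  (lpos event_word u k <= rpos event_word v k)%N = (l u k <= r v k).
Proof.
move=> kn; rewrite /lpos /rpos /pos lab_event_word.
have ue : (u, (2 * k).+1) \in events by rewrite mem_events; lia.
have ve : (v, (2 * k).+2) \in events by rewrite mem_events; lia.
have k1 : (2 * k).+1.-1./2 = k by lia.
have k2 : (2 * k).+2.-1./2 = k by lia.
have o1 : odd (2 * k).+1 = true by lia.
have o2 : odd (2 * k).+2 = false by lia.
case: (leP (l u k) (r v k)) => uv.
  apply/ltnW/event_index_lt => //; rewrite /event_key.
  by rewrite [(_, _).2]/= [(_, _).1]/= k1 k2 o1 o2 !ltxi_pair lexx uv implybT.
apply/negbTE; rewrite -ltnNge; apply: event_index_lt => //; rewrite /event_key.
rewrite [(_, _).2]/= [(_, _).1]/= k1 k2 o1 o2 !ltxi_pair lexx (ltW uv) /=.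
by rewrite leNgt uv.
Qed.

End TrapezoidsToWord.

Theorem theorem8 (R : realType) (d : nat) (d_ge1 : (1 <= d)%N)
    (h : 'I_d -> R) (h_incr : forall i j : 'I_d, (i < j)%N -> h i < h j) :
  uniform_lang (2 * d) (Ltrap d) /\
  forall G : sgraph, in_lang_class (Ltrap d) G <-> trapezoid_graph h G.
Proof.
split; first by move=> w /and3P[c0 c1 _]; apply/andP.
case: d d_ge1 h h_incr => // n _ h h_incr G; split.
  move=> [A [w iso]]; apply: trapezoid_graph_isomorphic iso _.
  exact: word_graph_trapezoid.
move=> [l' [r' [lr' GE]]].
pose l v k := l' v (inord k); pose r v k := r' v (inord k).
have lr v k : (k <= n)%N -> l v k <= r v k by move=> _; exact: lr'.
pose w := event_word n l r.
(* Every vertex occurs in the word, so its letter set is the whole vertex set of [G]. *)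
have inw v : v \in w by rewrite -has_pred1 has_count count_event_word.
exists G, w; exists (fun v => SeqSub (inw v)); split.
  by exists val => [v|v] //; apply: val_inj.
move=> u v; rewrite /= /word_edge -val_eqE /=.
have [->|uv] := eqVneq u v; first by rewrite edge_irr.
have lE x : l' x = (fun i : 'I_n.+1 => l x i).
  by apply/funext => i; rewrite /l inord_val.
have rE x : r' x = (fun i : 'I_n.+1 => r x i).
  by apply/funext => i; rewrite /r inord_val.
suff tE : trap_pred n.+1 (proj_word u v w) <-> edge u v by apply/idP/idP => /tE.
rewrite (trap_pred_proj uv (count_event_word lr u) (count_event_word lr v)).
rewrite GE // !lE !rE (trapezoids_meet h_incr (lr u) (lr v)).
by apply: eq_meet => k kn; rewrite event_word_le.
Qed.
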